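(* Let $\Omega$ be a bounded, convex, open subset of $\mathbb{R}^2$ and $M$ a minimal two-phase partitioning of $\Omega$ with length $L$. Assume there is a neighborhood of the points $\partial M$ in $\Sigma=\partial\Omega$ which is a $C^2$ curve and that the curvatures of $\Sigma$ at these points are $\sigma_1,\sigma_2>0$. If $L$ satisfies the condition $$L>2\,\frac{\sigma_1+\sigma_2+\sqrt{\sigma_1^2+\sigma_2^2-\sigma_1\sigma_2}}{\sigma_1\sigma_2},$$ then $M$ is unstable.
   Context: In dimension 2 the interface $M$ is a single curve of length $L$ in $\overline\Omega$ with its two endpoints on $\Sigma$, dividing $\Omega$ into two phases. It is minimal if the first variation of length vanishes for all variations preserving $\Sigma$ and the areas of the phases; equivalently, $M$ is a line segment or circular arc of constant curvature $\kappa\geqslant0$ ($\kappa=1/R$, or $0$ for a segment) meeting $\Sigma$ orthogonally at its endpoints. Parametrize $M$ by arc length $s\in[0,L]$; $\sigma_1$ is the curvature of $\Sigma$ at the endpoint $s=0$ and $\sigma_2$ at $s=L$ (nonnegative for convex $\Omega$). The second variation of area is $$J(f)=\int_0^L\left(f'(s)^2-\kappa^2f(s)^2\right)ds-\sigma_1f(0)^2-\sigma_2f(L)^2 .$$ $M$ is unstable if $J(f)<0$ for some admissible $f$, i.e. some $f\in H^1(0,L)$ with $\int_0^Lf\,ds=0$. *)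

(* Defs.v *)
From HB Require Import structures.
From mathcomp Require Import all_boot all_order all_algebra.
From mathcomp Require Import all_classical all_reals all_analysis.

Set Implicit Arguments.
Unset Strict Implicit.
Unset Printing Implicit Defensive.

Import Order.TTheory GRing.Theory Num.Theory.
Import numFieldNormedType.Exports.

Local Open Scope classical_set_scope.
Local Open Scope ring_scope.

(* The plane is R * R. Its library norm is the sup norm, which serves only for
   topology and differentiation; metric notions use [enorm]. *)
Definition enorm (R : realType) (u : R * R) : R :=
  Num.sqrt (u.1 ^+ 2 + u.2 ^+ 2).

Definition cross (R : realType) (u v : R * R) : R := u.1 * v.2 - u.2 * v.1.

Definition area (R : realType) (A : set (R * R)) : \bar R :=
  (lebesgue_measure \x lebesgue_measure)%E A.

Definition boundary (R : realType) (A : set (R * R)) : set (R * R) :=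
  closure A `\` interior A.

(* In finite dimension, existence and continuity of all directional derivatives
   on an open set U is continuous differentiability on U. *)
Definition C1_on (R : realType) (V W : normedModType R) (U : set V)
    (f : V -> W) : Prop :=
  forall v x, U x -> derivable f x v /\ {for x, continuous ('D_v f)}.

Definition C2_on (R : realType) (V W : normedModType R) (U : set V)
    (f : V -> W) : Prop :=
  C1_on U f /\ forall v, C1_on U ('D_v f : V -> W).

(* Unsigned curvature of a regular parametrized curve. *)
Definition curvature (R : realType) (c : R -> R * R) (s : R) : R :=
  `|cross (derive1 c s) (derive1n 2 c s)| / enorm (derive1 c s) ^+ 3.

Definition curve_length (R : realType) (c : R -> R * R) (a b : R) : R :=
  \int[lebesgue_measure]_(s in `[a, b]) enorm (derive1 c s).

(* Near p the set S is a regular C^2 curve whose curvature at p is k. When S is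
   the boundary of a convex set, the unsigned curvature is the curvature with
   respect to the inner normal. *)
Definition C2_curve_near_with_curvature (R : realType) (S : set (R * R))
    (p : R * R) (k : R) : Prop :=
  exists (d : R) (b : R -> R * R) (U : set (R * R)),
    [/\ 0 < d, open U & U p] /\
    [/\ C2_on `]- d, d[%classic b,
        forall u, u \in `]- d, d[ -> derive1 b u != 0,
        {in `]- d, d[ &, injective b},
        S `&` U = b @` `]- d, d[
      & b 0 = p /\ curvature b 0 = k].

(* The curve c, parametrized by arc length on [0, L], is the interface of a
   partition of Omega into two phases E1 and E2. *)
Definition two_phase_partitioning (R : realType) (Omega E1 E2 : set (R * R))
    (c : R -> R * R) (L : R) : Prop :=
  let M := c @` `[0, L] in
  [/\ 0 < L,
      exists2 e : R, 0 < e & C2_on `]- e, L + e[%classic c,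
      forall s, s \in `[0, L] -> enorm (derive1 c s) = 1
    & {in `[0, L] &, injective c}] /\
  [/\ M `<=` closure Omega, boundary Omega (c 0) & boundary Omega (c L)] /\
  [/\ open E1 /\ E1 !=set0, open E2 /\ E2 !=set0, E1 `&` E2 = set0,
      Omega `\` M = E1 `|` E2
    & Omega `&` closure E1 `&` closure E2 = Omega `&` M].

(* One-parameter C^2 family of deformations of the closure of Omega, starting
   at the identity, preserving Omega, its boundary and the areas of E1, E2. *)
Definition admissible_variation (R : realType) (Omega E1 E2 : set (R * R))
    (e : R) (Psi : R -> R * R -> R * R) : Prop :=
  [/\ 0 < e,
      exists U : set (R * (R * R)),
        [/\ open U,
            forall t x, `|t| < e -> closure Omega x -> U (t, x)
          & C2_on U (fun tx : R * (R * R) => Psi tx.1 tx.2)],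
      forall x, closure Omega x -> Psi 0 x = x
    & forall t, `|t| < e ->
        [/\ {in closure Omega &, injective (Psi t)},
            Psi t @` Omega = Omega,
            Psi t @` boundary Omega = boundary Omega,
            area (Psi t @` E1) = area E1
          & area (Psi t @` E2) = area E2]].

Definition minimal_partitioning (R : realType) (Omega E1 E2 : set (R * R))
    (c : R -> R * R) (L : R) : Prop :=
  two_phase_partitioning Omega E1 E2 c L /\
  forall (e : R) (Psi : R -> R * R -> R * R),
    admissible_variation Omega E1 E2 e Psi ->
    is_derive (0 : R) (1 : R) (fun t : R => curve_length (Psi t \o c) 0 L) 0.

Definition square_integrable (R : realType) (D : set R) (f : R -> R) : Prop :=
  measurable_fun D f /\
  lebesgue_measure.-integrable D (fun x => (f x ^+ 2)%:E).

Definition test_function (R : realType) (a b : R) (phi : R -> R) : Prop :=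
  (forall n x, derivable (derive1n n phi) x 1) /\
  exists a' b' : R, [/\ a < a', b' < b & forall x, x \notin `[a', b'] -> phi x = 0].

(* f is the continuous representative on [a, b] of an element of H^1(a, b), with
   weak derivative g; endpoint values of H^1 functions are those of this
   representative. *)
Definition H1_with_derivative (R : realType) (a b : R) (f g : R -> R) : Prop :=
  [/\ {within `[a, b], continuous f},
      square_integrable `[a, b] f,
      square_integrable `[a, b] g
    & forall phi, test_function a b phi ->
        \int[lebesgue_measure]_(x in `[a, b]) (f x * derive1 phi x) =
        - \int[lebesgue_measure]_(x in `[a, b]) (g x * phi x)].

(* g stands for the weak derivative of f. The curvature of a minimal curve is
   constant. *)
Definition second_variation (R : realType) (c : R -> R * R)
    (L sigma1 sigma2 : R) (f g : R -> R) : R :=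
  \int[lebesgue_measure]_(s in `[0, L])
     (g s ^+ 2 - curvature c s ^+ 2 * f s ^+ 2)
  - sigma1 * f 0 ^+ 2 - sigma2 * f L ^+ 2.

Definition unstable (R : realType) (c : R -> R * R)
    (L sigma1 sigma2 : R) : Prop :=
  exists f g : R -> R,
    [/\ H1_with_derivative 0 L f g,
        \int[lebesgue_measure]_(s in `[0, L]) f s = 0
      & second_variation c L sigma1 sigma2 f g < 0].

(* Main.v *)
Require Import Defs.
From HB Require Import structures.
From mathcomp Require Import all_boot all_order all_algebra.
From mathcomp Require Import all_classical all_reals all_analysis.
From mathcomp Require Import measurable_realfun ring lra.

Import Order.TTheory GRing.Theory Num.Theory.
Import numFieldNormedType.Exports.

Local Open Scope classical_set_scope.
Local Open Scope ring_scope.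

(** The test function is the affine function [f s = s - L / 2], which has zero
    mean and derivative 1. Dropping the curvature term, which only decreases the
    second variation, leaves [J f <= L - (sigma1 + sigma2) * L ^+ 2 / 4], and this
    is negative as soon as [L > 4 / (sigma1 + sigma2)]. The assumed lower bound on
    [L] is stronger, since [sigma1 * sigma2 <= (sigma1 + sigma2) ^+ 2 / 4]. *)

(* No measurability of [f] is needed: the integral of the positive part is a
   supremum over simple functions, hence monotone, and if the negative part has
   integral +oo then the real-valued integral is 0 by convention. This makes the
   regularity of the curvature irrelevant. *)
Lemma Rintegral_le_nonneg (d : measure_display) (T : measurableType d)
    (R : realType) (mu : {measure set T -> \bar R}) (D : set T) (f g : T -> R) :
  mu.-integrable D (EFin \o g) -> measurable D ->
  (forall x, D x -> 0 <= g x) -> (forall x, D x -> f x <= g x) ->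
  \int[mu]_(x in D) f x <= \int[mu]_(x in D) g x.
Proof.
move=> ig mD g0 fg; rewrite /Rintegral.
have ig0 : (0 <= \int[mu]_(x in D) (g x)%:E)%E.
  by apply: integral_ge0 => x Dx; rewrite lee_fin g0.
have fing : (\int[mu]_(x in D) (g x)%:E)%E \is a fin_num.
  exact: integrable_fin_num.
have le_pos : (\int[mu]_(x in D) (EFin \o f)^\+ x <=
               \int[mu]_(x in D) (g x)%:E)%E.
  rewrite !ge0_integralE//.
  apply: le_ereal_sup => _ [h /= hle <-]; exists h => //= x.
  apply: le_trans (hle x) _; rewrite !patchE; case: ifPn => // /set_mem Dx.
  by rewrite funeposE /= ge_max !lee_fin fg// g0.
have pos0 : (0 <= \int[mu]_(x in D) (EFin \o f)^\+ x)%E by exact: integral_ge0.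
have neg0 : (0 <= \int[mu]_(x in D) (EFin \o f)^\- x)%E by exact: integral_ge0.
rewrite integralE.
(* Finiteness of the integral of [g] rules out an infinite positive part, so the only infinite case
   left is a negative part equal to [+oo], where [fine] returns 0. *)
move: ig0 fing le_pos pos0 neg0.
case: (integral _ _ (fun x => (g x)%:E)) => // G G0 _.
case: (integral _ _ (_^\+)%E) => // p pG p0.
case: (integral _ _ (_^\-)%E) => // n n0 /=.
by move: G0 pG n0; rewrite !lee_fin; lra.
Qed.

Section affine_test_function.
Context {R : realType}.
Local Notation mu := (@lebesgue_measure R).
Implicit Types a b m x : R.

Let translate m x := x - m.

Let derivable_translate m x : derivable (translate m) x 1.
Proof. by apply: derivableB. Qed.

Let derive1_translate m x : derive1 (translate m) x = 1.
Proof. by rewrite derive1E deriveB// derive_id derive_cst subr0. Qed.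

(** Supplies the endpoint regularity that integration by parts asks for. *)
Lemma derivable_oo_LRcontinuousT (f : R -> R) a b :
  (forall x, derivable f x 1) -> derivable_oo_LRcontinuous f a b.
Proof.
move=> df.
have cf x : {for x, continuous f}.
  by apply/differentiable_continuous/derivable1_diffP.
split=> [//||].
- exact/cvg_at_right_filter/cf.
- exact/cvg_at_left_filter/cf.
Qed.

Let continuous_translate m : continuous (translate m).
Proof. by move=> x; apply/differentiable_continuous/derivable1_diffP. Qed.

Lemma continuous_square_integrable (f : R -> R) a b :
  continuous f -> square_integrable `[a, b] f.
Proof.
move=> cf; split.
  by apply: measurable_funTS; exact: continuous_measurable_fun.
apply: (@continuous_compact_integrable _ (fun x => f x ^+ 2)).
  exact: segment_compact.
apply: continuous_subspaceT => x.
exact: (continuous_comp (cf x) (@exprn_continuous R 2 (f x))).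
Qed.

Lemma H1_with_derivative_translate a b m : a < b ->
  H1_with_derivative a b (fun s => s - m) (cst 1).
Proof.
move=> ab; split.
- exact/continuous_subspaceT/continuous_translate.
- exact/continuous_square_integrable/continuous_translate.
- by apply: continuous_square_integrable => x; exact: cvg_cst.
move=> phi [dphi [a' [b' [aa' bb' phi0]]]].
rewrite (@Rintegration_by_parts _ (translate m) phi (cst 1) (derive1 phi))//.
(* The boundary terms vanish: [a] and [b] lie outside the support interval [[a', b']]. *)
- rewrite (phi0 a) ?(phi0 b) ?mulr0 ?subrr ?sub0r//.
    by rewrite in_itv/= negb_and -!ltNge bb' orbT.
  by rewrite in_itv/= negb_and -!ltNge aa'.
- by apply: continuous_subspaceT => x; exact: cvg_cst.
- exact: derivable_oo_LRcontinuousT.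
- apply: continuous_subspaceT => x.
  exact/differentiable_continuous/derivable1_diffP/(dphi 1%N).
- exact: derivable_oo_LRcontinuousT (dphi 0%N).
Qed.

(** Integrating [1 * (s - m)] by parts gives the integral [I] as a boundary term minus [I]. The
    endpoints are symmetric about [m], so the boundary term is 0 and [I = - I]. *)
Lemma Rintegral_sub_midpoint a b : a < b ->
  \int[mu]_(s in `[a, b]) (s - (a + b) / 2) = 0.
Proof.
move=> ab; set m := (a + b) / 2.
have := @Rintegration_by_parts _ (translate m) (translate m) (cst 1) (cst 1)
  _ _ ab.
have c1 : {within `[a, b], continuous (cst 1 : R -> R)}.
  by apply: continuous_subspaceT => x; exact: cvg_cst.
have dm := derivable_oo_LRcontinuousT _ a b (derivable_translate m).
have D1 : {in `]a, b[, derive1 (translate m) =1 cst 1}.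
  by move=> x _; rewrite derive1_translate.
move=> /(_ c1 dm D1 c1 dm D1).
under eq_Rintegral do rewrite mulr1.
under [in X in _ = X -> _]eq_Rintegral do rewrite mul1r.
rewrite /translate /m; set I := (\int[_]_(_ in _) _).
have -> : (b - (a + b) / 2) * (b - (a + b) / 2) -
          (a - (a + b) / 2) * (a - (a + b) / 2) = 0 by field.
lra.
Qed.

Lemma second_variation_sub_midpoint (c : R -> R * R) (L sigma1 sigma2 : R) :
  0 <= L ->
  second_variation c L sigma1 sigma2 (fun s => s - L / 2) (cst 1)
  <= L - (sigma1 + sigma2) * L ^+ 2 / 4.
Proof.
move=> L0; rewrite /second_variation.
have int1 : mu.-integrable `[0, L] (EFin \o cst 1).
  apply: continuous_compact_integrable; first exact: segment_compact.
  by apply: continuous_subspaceT => x; exact: cvg_cst.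
have muL : mu `[0, L]%classic = L%:E.
  (* The interval formula splits on [0 < L]; the other case forces [L = 0]. *)
  rewrite lebesgue_measure_itv/= lte_fin oppr0 adde0; case: ltP => // L0'.
  by congr EFin; apply/eqP; rewrite eq_le L0.
set J := (\int[_]_(_ in _) _).
have : J <= L.
  have -> : L = \int[mu]_(s in `[0, L]) cst 1 s.
    by rewrite Rintegral_cst// mul1r; exact/esym/(congr1 fine muL).
  apply: Rintegral_le_nonneg => // x _.
  by rewrite /= expr1n gerBl mulr_ge0// sqr_ge0.
(* The test function takes the values [- L / 2] and [L / 2] at the endpoints, each with square
   [L ^+ 2 / 4]. *)
rewrite sub0r; nra.
Qed.

End affine_test_function.

Lemma length_bound_gt (R : realType) (L s t : R) : 0 < s -> 0 < t ->
  L > 2 * ((s + t + Num.sqrt (s ^+ 2 + t ^+ 2 - s * t)) / (s * t)) ->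
  4 < (s + t) * L.
Proof.
move=> s0 t0; set q := Num.sqrt _ => Lq.
have q0 : 0 <= q := sqrtr_ge0 _.
have st0 : 0 < s * t by rewrite mulr_gt0.
have {}Lq : 2 * (s + t + q) < L * (s * t) by rewrite -ltr_pdivrMr// -mulrA.
have Lst : 2 * (s + t) < L * (s * t) by lra.
(* Multiplying [Lst] by [s + t] gives [(s + t) * L * (s * t) > 2 * (s + t) ^+ 2], and the right side
   is at least [8 * (s * t)]. *)
rewrite -(ltr_pM2l st0); nra.
Qed.

Theorem proposition25 (R : realType) (Omega E1 E2 : set (R * R))
    (gamma : R -> R * R) (L sigma1 sigma2 : R)
    (Omega_open : open Omega)
    (Omega_bounded : bounded_set Omega)
    (Omega_convex : convex_set Omega)
    (M_minimal : minimal_partitioning Omega E1 E2 gamma L)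
    (Sigma_C2_0 :
      C2_curve_near_with_curvature (boundary Omega) (gamma 0) sigma1)
    (Sigma_C2_L :
      C2_curve_near_with_curvature (boundary Omega) (gamma L) sigma2)
    (sigma1_gt0 : 0 < sigma1) (sigma2_gt0 : 0 < sigma2)
    (L_large :
      L > 2 * ((sigma1 + sigma2
                + Num.sqrt (sigma1 ^+ 2 + sigma2 ^+ 2 - sigma1 * sigma2))
               / (sigma1 * sigma2))) :
  unstable gamma L sigma1 sigma2.
Proof.
have L0 : 0 < L by case: M_minimal => -[] [].
have L4 := length_bound_gt _ _ _ _ sigma1_gt0 sigma2_gt0 L_large.
exists (fun s => s - L / 2), (cst 1); split.
- exact: H1_with_derivative_translate.
- by have := Rintegral_sub_midpoint _ _ L0; rewrite add0r.
(* The upper bound factors as [L * (4 - (sigma1 + sigma2) * L) / 4], negative by [L0] and [L4]. *)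
apply: (le_lt_trans (second_variation_sub_midpoint _ _ _ _ (ltW L0))); nra.
Qed.
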